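(* Let $m,n\ge 3$ be integers with $mn$ even, and let $\Gamma$ be an Abelian group of order $mn$ with exponent $r$. If $2r\gcd(m,n)<\operatorname{lcm}(m,n)$, then there does not exist a $\Gamma$-distance magic labeling of the Cartesian product $C_m\square C_n$.
   Context: The exponent of a finite group $\Gamma$ is the smallest positive integer $r$ such that $ra=0$ for all $a\in\Gamma$. $C_k$ denotes the cycle on $k\ge 3$ vertices. The Cartesian product $G\square H$ of graphs $G,H$ has vertex set $V(G)\times V(H)$; $(g,h)$ and $(g',h')$ are adjacent iff either $g=g'$ and $h$ is adjacent to $h'$ in $H$, or $h=h'$ and $g$ is adjacent to $g'$ in $G$. For a finite simple graph $G=(V,E)$ and an Abelian group $\Gamma$ (written additively) with $|\Gamma|=|V|$, a $\Gamma$-distance magic labeling of $G$ is a bijection $\ell\colon V\to\Gamma$ for which there exists $\mu\in\Gamma$ such that $\sum_{u\in N(v)}\ell(u)=\mu$ for every $v\in V$, where $N(v)$ is the open neighborhood of $v$. *)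

(* Defs.v *)
From mathcomp Require Import all_boot all_order all_algebra.
From mathcomp Require Import all_fingroup all_solvable.

Set Implicit Arguments.
Unset Strict Implicit.
Unset Printing Implicit Defensive.

Import GRing.Theory.
Local Open Scope ring_scope.

(* A graph on a finite vertex type V is an adjacency relation on V; the ones
   used here are symmetric and irreflexive (cycle_graph_sym, ...). *)

(* This is C_k for k >= 3; it is a single edge for k = 2, and a loop for
   k = 1. *)
Definition cycle_graph (k : nat) : rel 'I_k :=
  fun i j => (j == ordS i) || (i == ordS j).

Definition cartesian_product (V W : finType) (e : rel V) (f : rel W) :
    rel (V * W)%type :=
  fun x y => (x.1 == y.1) && f x.2 y.2 || (x.2 == y.2) && e x.1 y.1.

(* #|Gamma| = #|V| is implied by bijectivity. *)
Definition distance_magic_labeling (V : finType) (e : rel V)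
    (Gamma : finZmodType) (l : V -> Gamma) : Prop :=
  bijective l /\ exists mu : Gamma, forall v : V, \sum_(u | e v u) l u = mu.

Lemma cycle_graph_sym k : symmetric (@cycle_graph k).
Proof. by move=> i j; rewrite /cycle_graph orbC. Qed.

Lemma cycle_graph_irr k : (1 < k)%N -> irreflexive (@cycle_graph k).
Proof.
move=> k1 i; rewrite /cycle_graph orbb; apply/eqP => /(congr1 val) /= Ei.
have := ltn_ord i; rewrite leq_eqVlt => /orP[/eqP Ek | lt_ik].
  by have := Ei; rewrite Ek modnn => i0; move: k1; rewrite -{1}Ek i0.
by move: Ei; rewrite modn_small // => /eqP; rewrite eqn_leq ltnn andbF.
Qed.

Lemma cartesian_product_sym (V W : finType) (e : rel V) (f : rel W) :
  symmetric e -> symmetric f -> symmetric (cartesian_product e f).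
Proof.
move=> se sf x y; rewrite /cartesian_product se sf.
by rewrite (eq_sym x.1) (eq_sym x.2).
Qed.

Lemma cartesian_product_irr (V W : finType) (e : rel V) (f : rel W) :
  irreflexive e -> irreflexive f -> irreflexive (cartesian_product e f).
Proof. by move=> ie jf x; rewrite /cartesian_product ie jf !andbF. Qed.

(* The library's exponent, written multiplicatively and defined as the lcm of
   the orders of the elements, is the least r > 0 with r a = 0 for all a. *)
Lemma exponent_zmodP (Gamma : finZmodType) (r : nat) :
  r = exponent [set: Gamma] <->
  [/\ (0 < r)%N, forall a : Gamma, a *+ r = 0
    & forall s, (0 < s)%N -> (forall a : Gamma, a *+ s = 0) -> (r <= s)%N].
Proof.
have kill s : (forall a : Gamma, a *+ s = 0) <-> (exponent [set: Gamma] %| s)%N.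
  split=> [h | /exponentP h a]; first by apply/exponentP => a _; exact: h.
  by rewrite -FinRing.zmodXgE h ?inE.
split=> [-> | [r0 /kill dr minr]].
  split=> [||s s0 /kill]; [exact: exponent_gt0 | exact/kill |].
  exact: dvdn_leq.
apply/eqP; rewrite eqn_leq (dvdn_leq r0 dr) andbT.
by apply: minr; [exact: exponent_gt0 | exact/kill].
Qed.

(* Main.v *)
(** With S, T the unit shifts of the torus in its two directions, A = S T and
    B = S T^-1, the neighbourhood-sum operator S + S^-1 + T + T^-1 equals
    S^-1 (1 + A) (1 + B).  Hence for a magic labeling l the difference
    w = (A^2 - 1) l satisfies B w = - w, so B^2 w = w.  With g = gcd(m, n), the
    Chinese remainder theorem puts A^(2g) in the subgroup generated by B^2, so
    A^(2g) w = w.  Telescoping w along A^2 over r periods then gives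
    A^(2rg) l = l because r kills the group, although A has order
    lcm(m, n) > 2rg and l is injective. *)

Require Import Defs.
From mathcomp Require Import all_boot all_order all_algebra.
From mathcomp Require Import all_fingroup all_solvable.

Set Implicit Arguments.
Unset Strict Implicit.
Unset Printing Implicit Defensive.

Import GRing.Theory.

Section NeighbourhoodSums.
Local Open Scope ring_scope.

(** Indexing by naturals modulo [k] lifts the torus to a doubly periodic grid, where shifts are
    plain additions. *)
Definition cycle_vertex (k : nat) (k_gt0 : (0 < k)%N) (i : nat) : 'I_k :=
  Ordinal (ltn_pmod i k_gt0).

Lemma sum_cartesian_product (V W : finType) (e : rel V) (f : rel W)
    (G : nmodType) (F : V * W -> G) (x : V) (y : W) :
  irreflexive e ->
  \sum_(u | cartesian_product e f (x, y) u) F u =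
  \sum_(i | e x i) F (i, y) + \sum_(j | f y j) F (x, j).
Proof.
(* Irreflexivity of [e] keeps the neighbours that share the first coordinate disjoint from those
   that move it. *)
move=> ie; rewrite (bigID (fun u => u.1 == x)) /= addrC; congr (_ + _).
  rewrite (reindex_onto (fun i => (i, y)) fst) /=; last first.
    case=> i j; rewrite /cartesian_product /= eq_sym.
    by case/andP=> /orP[/andP[->] //|/andP[/eqP -> _]].
  apply: eq_bigl => i; rewrite /cartesian_product /= !eqxx andbT (eq_sym x).
  by case: eqP => [->|_]; rewrite ?ie ?andbF ?andbT.
rewrite (reindex_onto (fun j => (x, j)) snd) /=; last first.
  by case=> i j /andP[_ /= /eqP ->].
by apply: eq_bigl => j; rewrite /cartesian_product /= !eqxx ie andbF orbF !andbT.
Qed.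

Lemma sum_cycle_graph (k : nat) (k_gt0 : (0 < k)%N) (G : nmodType)
    (F : 'I_k -> G) (i : nat) :
  (3 <= k)%N ->
  \sum_(u | cycle_graph (cycle_vertex k_gt0 i.+1) u) F u =
  F (cycle_vertex k_gt0 i) + F (cycle_vertex k_gt0 i.+2).
Proof.
move=> k3; set p := cycle_vertex k_gt0.
have pS j : ordS (p j) = p j.+1.
  by apply: val_inj; rewrite /= -addn1 modnDml addn1.
have ordS_inj : injective (@ordS k) by apply: can_inj (@ordSK k).
rewrite (bigD1 (p i)) /=; last by rewrite /cycle_graph -!pS eqxx orbT.
congr (_ + _); apply: big_pred1 => u.
rewrite /cycle_graph -!pS (inj_eq ordS_inj) (eq_sym (p i)).
case: (u =P p i) => [-> | _]; last by rewrite orbF andbT.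
(* The two neighbours are distinct: [i] and [i + 2] differ modulo [k] because [2 < k]. *)
rewrite andbF !pS; apply/esym/eqP=> /(congr1 val) /= /eqP.
rewrite -[in X in X == _](addn0 i) -addn2 eqn_modDl mod0n.
by rewrite modn_small.
Qed.

End NeighbourhoodSums.

Section PeriodicGrid.
Local Open Scope ring_scope.
Variables (G : zmodType) (mu : G) (f : nat -> nat -> G) (m n : nat).
Hypothesis n_gt0 : (0 < n)%N.
Hypothesis f_per1 : forall a i j, f (i + a * m) j = f i j.
Hypothesis f_per2 : forall a i j, f i (j + a * n) = f i j.
Hypothesis f_magic :
  forall i j, f i j.+1 + f i.+2 j.+1 + (f i.+1 j + f i.+1 j.+2) = mu.

Let w i j := f i.+2 j.+2 - f i j.

(** The neighbourhoods of [(i+1, j+1)] and [(i+2, j+2)] share [(i+1, j+2)] and [(i+2, j+1)];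
    cancelling these in the two magic equations leaves the relation. *)
Lemma diag_diff_antidiag i j : w i.+1 j = - w i j.+1.
Proof.
apply/eqP; rewrite -subr_eq0 opprK /w.
rewrite addrACA -opprD subr_eq0.
rewrite -(inj_eq (addIr (f i.+1 j.+2 + f i.+2 j.+1))).
apply/eqP; transitivity mu; last first.
  by rewrite -(f_magic i j) [RHS]addrACA [RHS]addrC.
by rewrite -(f_magic i.+1 j.+1) [RHS]addrACA [RHS]addrC.
Qed.

Lemma diag_diff_antidiag_even k i j : w (i + k.*2) j = w i (j + k.*2).
Proof.
elim: k i j => [|k IHk] i j; first by rewrite !addn0.
by rewrite doubleS !addnS -!addSn !diag_diff_antidiag IHk opprK !addSn.
Qed.

Lemma diag_diff_periodic i j :
  w (i + (gcdn m n).*2) (j + (gcdn m n).*2) = w i j.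
Proof.
have w1 a i' j' : w (i' + a * m) j' = w i' j' by rewrite /w -!addSn !f_per1.
have w2 a i' j' : w i' (j' + a * n) = w i' j' by rewrite /w -!addSn !f_per2.
case: (egcdnP m n_gt0) => b a; rewrite gcdnC => Eb _.
(* Bezout gives [b n = a m + g]. Shift the first index on the left by [4 a m] and the second index
   on the right by [4 b n]. Moving the left shift [2 g + 4 a m] to the second index makes its total
   shift [4 g + 4 a m = 4 b n]. *)
rewrite -(w1 a.*2.*2) -(w2 b.*2.*2 i) -!doubleMl Eb -addnA -doubleD.
rewrite diag_diff_antidiag_even -addnA -doubleD; congr (w i (j + _.*2)).
by rewrite addnA addnn -doubleD addnC.
Qed.

Lemma diag_periodic r i j :
  (forall x : G, x *+ r = 0) ->
  f (i + (r * gcdn m n).*2) (j + (r * gcdn m n).*2) = f i j.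
Proof.
set g := gcdn m n => kill_r.
have telescope k i' j' :
    f (i' + k.*2) (j' + k.*2) = f i' j' + \sum_(s < k) w (i' + s.*2) (j' + s.*2).
  elim: k => [|k IHk]; first by rewrite !addn0 big_ord0 addr0.
  by rewrite big_ord_recr /= addrA -IHk /w doubleS !addnS addrC subrK.
have w_period q i' j' : w (i' + (q * g).*2) (j' + (q * g).*2) = w i' j'.
  elim: q => [|q IHq]; first by rewrite !addn0.
  by rewrite mulSnr doubleD !addnA diag_diff_periodic.
pose D := \sum_(s < g) w (i + s.*2) (j + s.*2).
(* The increments repeat after [g] diagonal double steps, so each block adds the same [D]; [r]
   blocks add [D *+ r = 0]. *)
have block q : f (i + (q * g).*2) (j + (q * g).*2) = f i j + D *+ q.
  elim: q => [|q IHq]; first by rewrite !addn0 addr0.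
  rewrite mulSnr doubleD !addnA telescope IHq -addrA mulrSr; congr (_ + (_ + _)).
  by apply: eq_bigr => s _; rewrite addnAC (addnAC j) w_period.
by rewrite block kill_r addr0.
Qed.

End PeriodicGrid.

Theorem theorem3p2 (m n : nat) (Gamma : finZmodType) (r : nat)
    (hm : 3 <= m) (hn : 3 <= n) (hmn : ~~ odd (m * n))
    (hG : #|Gamma| = m * n) (hr : r = exponent [set: Gamma])
    (hlt : 2 * r * gcdn m n < lcmn m n) :
  ~ exists l : 'I_m * 'I_n -> Gamma,
      distance_magic_labeling
        (cartesian_product (@cycle_graph m) (@cycle_graph n)) l.
Proof.
case=> l [l_bij [mu l_magic]].
have [r_gt0 kill_r _] := (exponent_zmodP Gamma r).1 hr.
have m_gt0 : 0 < m by apply: leq_trans hm.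
have n_gt0 : 0 < n by apply: leq_trans hn.
pose f i j := l (cycle_vertex m_gt0 i, cycle_vertex n_gt0 j).
have f_per1 a i j : f (i + a * m) j = f i j.
  by congr (l (_, _)); apply: val_inj; rewrite /= addnC modnMDl.
have f_per2 a i j : f i (j + a * n) = f i j.
  by congr (l (_, _)); apply: val_inj; rewrite /= addnC modnMDl.
have f_magic i j :
    (f i j.+1 + f i.+2 j.+1 + (f i.+1 j + f i.+1 j.+2) = mu)%R.
  rewrite -(l_magic (cycle_vertex m_gt0 i.+1, cycle_vertex n_gt0 j.+1)).
  rewrite sum_cartesian_product; last exact/cycle_graph_irr/ltnW.
  by rewrite !sum_cycle_graph.
have := diag_periodic n_gt0 f_per1 f_per2 f_magic 0 0 kill_r.
(* Injectivity of [l] at the origin makes both [m] and [n] divide [2 r g]. *)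
move=> /(bij_inj l_bij) [/eqP]; rewrite !add0n !mod0n => dm /eqP dn.
have : lcmn m n %| (r * gcdn m n).*2 by rewrite dvdn_lcm /dvdn dm dn.
(* As [2 r g] is positive, divisibility bounds the lcm by it, against [hlt]. *)
move=> /dvdn_leq; rewrite double_gt0 muln_gt0 r_gt0 gcdn_gt0 m_gt0 => /(_ isT).
by rewrite -mul2n mulnA leqNgt hlt.
Qed.
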